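(* In the hyperbolic plane with absolute conic $\mathcal{N}\colon x_1^2+x_2^2-x_0^2=0$, let $$\mathcal{C}\colon \lambda(x_1^2+x_2^2-x_0^2)+(x_1-x_0)(x_1+x_0)=0,\qquad \lambda\in\mathbb{R}\setminus\{0,-1\},$$ be a circle whose points of tangency with $\mathcal{N}$ are real. Its Frégier conic is $$\mathcal{F}\colon \lambda^3(x_1^2+x_2^2-x_0^2)+(5\lambda^2+8\lambda+4)(x_1-x_0)(x_1+x_0)=0.$$ Unless $\lambda=-2$, it is again a circle; it shares the symmetries of $\mathcal{C}$, and it lies in the interior of $\mathcal{N}$ if and only if $\mathcal{C}$ does. The conic $\mathcal{F}$ is singular if $\lambda^3(\lambda+2)^4(\lambda+1)^2=0$; hence, for the admissible values of $\lambda$, the Frégier locus is singular precisely for $\lambda=-2$. In this case it degenerates to the line with equation $x_2=0$, that is, the span of the two points of tangency; more precisely, only interior points of $\mathcal{N}$ occur as real Frégier points. Moreover, in this case the lines connecting any point $p\in\mathcal{C}$ with the two points of tangency are perpendicular.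
   Context: Points have homogeneous coordinates $[x_0,x_1,x_2]$; points inside and outside the absolute conic $\mathcal{N}$ are treated equally (universal hyperbolic geometry). Two lines are perpendicular if they are conjugate with respect to $\mathcal{N}$. A circle is a conic having double contact with $\mathcal{N}$, i.e. the four base points of the pencil spanned by the conic and $\mathcal{N}$ form precisely two pairs of coinciding points (the points of tangency). For a regular conic $\mathcal{C}$ and $p\in\mathcal{C}$, the Frégier point $f(\mathcal{C},p)$ is the point common to the hypotenuses of all right triangles inscribed into $\mathcal{C}$ with right angle at $p$; equivalently, it is the pole with respect to $\mathcal{C}$ of the line $i\vee\overline{i}$, where $i$ and $\overline{i}$ are the projections of $p$ onto $\mathcal{C}$ via the isotropic lines through $p$ (the possibly complex tangents of $\mathcal{N}$ through $p$). The Frégier locus of $\mathcal{C}$ is $\mathcal{F}=\{f(\mathcal{C},p)\mid p\in\mathcal{C}\}$; if it is a conic it is called the Frégier conic of $\mathcal{C}$, and it is called singular if it is not a regular conic. *)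

(* Defs.v *)
From mathcomp Require Import all_boot all_order all_algebra.
From mathcomp Require Import reals complex ring.
Set Implicit Arguments.
Unset Strict Implicit.
Unset Printing Implicit Defensive.
Import Order.TTheory GRing.Theory Num.Theory.
Local Open Scope ring_scope.

(* Points and lines of the projective plane over K are nonzero row vectors,    *)
(* compared up to a nonzero factor; a conic is given by its symmetric matrix.  *)
Section Plane.
Variable K : fieldType.
Implicit Types (p q r f g l m : 'rV[K]_3) (Q P : 'M[K]_3).

Definition hpt (x0 x1 x2 : K) : 'rV[K]_3 := \row_j [:: x0; x1; x2]`_j.

Definition same_pt p q : bool := (p == q)%MS.

Definition incident p l : bool := p *m l^T == 0.

Definition qform Q p : K := (p *m Q *m p^T) 0 0.

Definition on_conic Q p : bool := (p != 0) && (qform Q p == 0).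

Definition regular Q : bool := (Q^T == Q) && (Q \in unitmx).

(* The tangent at p when p lies on Q. *)
Definition polar Q p : 'rV[K]_3 := p *m Q.

(* x_1^2 + x_2^2 - x_0^2 *)
Definition absolute : 'M[K]_3 := diag_mx (hpt (-1) 1 1).

(* (x_1 - x_0)(x_1 + x_0) *)
Definition tangent_pair : 'M[K]_3 := diag_mx (hpt (-1) 1 0).

Definition conicC (lam : K) : 'M[K]_3 := lam *: absolute + tangent_pair.

Definition conicF (lam : K) : 'M[K]_3 :=
  lam ^+ 3 *: absolute + (5 * lam ^+ 2 + 8 * lam + 4) *: tangent_pair.

(* The pole of l with respect to the absolute conic lies on m. *)
Definition perpendicular l m : bool := incident (l *m invmx absolute) m.

Definition touch P Q p : bool :=
  [&& on_conic P p, on_conic Q p & same_pt (polar P p) (polar Q p)].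

(* The base points are a, a, b, b: contact at a and at b, which together       *)
(* account for all four intersections, and no further common point.  Meant     *)
(* for K algebraically closed and P, Q regular.                                *)
Definition double_contact P Q (a b : 'rV[K]_3) : Prop :=
  [/\ ~~ same_pt a b, touch P Q a, touch P Q b
    & forall p, on_conic P p -> on_conic Q p -> same_pt p a \/ same_pt p b].

Definition contact1 : 'rV[K]_3 := hpt 1 1 0.

Definition contact2 : 'rV[K]_3 := hpt 1 (-1) 0.

Definition circle Q : Prop :=
  regular Q /\ exists a b, double_contact absolute Q a b.

(* The line joining the points p and q of Q; the chord degenerates to the      *)
(* tangent of Q at p if q = p.                                                 *)
Definition chord Q p q l : Prop :=
  [/\ l != 0, incident p l, incident q l & same_pt p q -> same_pt l (polar Q p)].

(* Allowing a leg to degenerate to the tangent at p adds no condition when p   *)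
(* is not on the absolute conic, the resulting hypotenuse being the normal of  *)
(* Q at p.  At a point p of contact with the absolute conic, where no proper   *)
(* right triangle exists, it yields p itself as Fregier point; this is also    *)
(* the pole of the line joining the projections of p along the isotropic       *)
(* lines, since both projections coincide with p and their join is the tangent.*)
Definition right_triangle Q p q r : Prop :=
  [/\ on_conic Q q, on_conic Q r, ~~ same_pt q r
    & exists l m, [/\ chord Q p q l, chord Q p r m & perpendicular l m]].

Definition on_all_hypotenuses Q p g : Prop :=
  forall q r, right_triangle Q p q r -> (g <= q + r)%MS.

Definition fregier_point Q p f : Prop :=
  f != 0 /\ forall g, g != 0 -> (on_all_hypotenuses Q p g <-> same_pt g f).

Definition fregier_locus Q f : Prop :=
  exists2 p, on_conic Q p & fregier_point Q p f.

Definition fregier_conic Q P : Prop :=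
  forall f, fregier_locus Q f <-> on_conic P f.

(* g acts on points by x |-> x *m g. *)
Definition preserves Q (g : 'M[K]_3) : Prop :=
  exists2 k : K, k != 0 & g *m Q *m g^T = k *: Q.

Definition symmetry Q (g : 'M[K]_3) : Prop :=
  [/\ g \in unitmx, preserves absolute g & preserves Q g].

Lemma qform_diag (a b c x0 x1 x2 : K) :
  qform (diag_mx (hpt a b c)) (hpt x0 x1 x2)
    = a * x0 ^+ 2 + b * x1 ^+ 2 + c * x2 ^+ 2.
Proof.
rewrite /qform mul_mx_diag mxE !big_ord_recl big_ord0 !mxE /=; ring.
Qed.

Lemma qformDZ (a b : K) Q P p :
  qform (a *: Q + b *: P) p = a * qform Q p + b * qform P p.
Proof.
by rewrite /qform mulmxDr mulmxDl -!scalemxAr -!scalemxAl !mxE.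
Qed.

Lemma qform_absolute x0 x1 x2 :
  qform absolute (hpt x0 x1 x2) = x1 ^+ 2 + x2 ^+ 2 - x0 ^+ 2.
Proof. by rewrite qform_diag; ring. Qed.

Lemma qform_conicC lam x0 x1 x2 :
  qform (conicC lam) (hpt x0 x1 x2)
    = lam * (x1 ^+ 2 + x2 ^+ 2 - x0 ^+ 2) + (x1 - x0) * (x1 + x0).
Proof.
rewrite /conicC -[tangent_pair]scale1r qformDZ qform_absolute qform_diag; ring.
Qed.

Lemma qform_conicF lam x0 x1 x2 :
  qform (conicF lam) (hpt x0 x1 x2)
    = lam ^+ 3 * (x1 ^+ 2 + x2 ^+ 2 - x0 ^+ 2)
      + (5 * lam ^+ 2 + 8 * lam + 4) * ((x1 - x0) * (x1 + x0)).
Proof. rewrite /conicF qformDZ qform_absolute qform_diag; ring. Qed.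

End Plane.

Arguments absolute {K}.
Arguments contact1 {K}.
Arguments contact2 {K}.

Definition interior (R : realType) (x : 'rV[R]_3) : bool :=
  qform absolute x < 0.

(* Circles touch the absolute conic, so points of contact must be tolerated.   *)
Definition lies_inside (R : realType) (Q : 'M[R]_3) : Prop :=
  forall x : 'rV[R]_3, on_conic Q x -> interior x \/ on_conic absolute x.

(* Main.v *)
Require Import Defs.
From mathcomp Require Import all_boot all_order all_algebra.
From mathcomp Require Import reals complex ring lra.
Set Implicit Arguments.
Unset Strict Implicit.
Unset Printing Implicit Defensive.
Import Order.TTheory GRing.Theory Num.Theory.
Local Open Scope ring_scope.
Local Open Scope complex_scope.

(** With u = x1 - x0, v = x1 + x0 and w = x2 the absolute conic is uv + w^2
    and C is (lam + 1) uv + lam w^2, so C is parametrized rationally by (s : t).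
    The chord joining two parameters (the tangent, if they coincide) is bilinear
    in them.  Perpendicularity of the legs from p to q and r is an equation
    bilinear in the parameters of q and r; it says that the chord qr passes
    through the image of p under the linear map
    (u, v, w) |-> (lam u, lam v, (lam + 2) w).  Hence this image is the Fregier
    point of p, and the Fregier locus is the image of C under a fixed linear
    map, which is singular exactly for lam = -2. *)

(** * Points, lines and joins in homogeneous coordinates *)

Section Field.
Variable K : fieldType.
Implicit Types (p q f g l m x y : 'rV[K]_3) (Q P : 'M[K]_3).

Lemma hpt_eta x : x = hpt (x 0 0) (x 0 1) (x 0 2).
Proof.
apply/rowP => j; rewrite mxE; case: j => [[|[|[|//]]] Hj] /=;
  by congr (x _ _); apply: val_inj.
Qed.

Lemma hpt2 (x0 x1 x2 : K) : hpt x0 x1 x2 0 2 = x2.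
Proof. by rewrite mxE. Qed.

Lemma hptW (S : 'rV[K]_3 -> Prop) :
  (forall x0 x1 x2 : K, S (hpt x0 x1 x2)) -> forall x, S x.
Proof. by move=> h x; rewrite (hpt_eta x). Qed.

Lemma hpt_eq (x0 x1 x2 y0 y1 y2 : K) :
  (hpt x0 x1 x2 == hpt y0 y1 y2) = [&& x0 == y0, x1 == y1 & x2 == y2].
Proof.
apply/eqP/and3P => [/rowP e|[/eqP-> /eqP-> /eqP->]//].
by move: (e 0) (e 1) (e 2); rewrite !mxE /= => -> -> ->.
Qed.

Lemma hpt_eq0 (x0 x1 x2 : K) :
  (hpt x0 x1 x2 == 0) = [&& x0 == 0, x1 == 0 & x2 == 0].
Proof.
suff -> : 0 = hpt 0 0 0 :> 'rV[K]_3 by apply: hpt_eq.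
by rewrite [LHS]hpt_eta !mxE.
Qed.

Lemma scale_hpt (k x0 x1 x2 : K) :
  k *: hpt x0 x1 x2 = hpt (k * x0) (k * x1) (k * x2).
Proof.
by rewrite [LHS]hpt_eta !mxE.
Qed.

Lemma hpt_mul_diag (x0 x1 x2 a b c : K) :
  hpt x0 x1 x2 *m diag_mx (hpt a b c) = hpt (x0 * a) (x1 * b) (x2 * c).
Proof. by rewrite [LHS]hpt_eta mul_mx_diag !mxE. Qed.

Lemma incident_hpt (x0 x1 x2 y0 y1 y2 : K) :
  incident (hpt x0 x1 x2) (hpt y0 y1 y2) = (x0 * y0 + x1 * y1 + x2 * y2 == 0).
Proof.
have -> : x0 * y0 + x1 * y1 + x2 * y2 =
    (hpt x0 x1 x2 *m (hpt y0 y1 y2)^T) 0 0.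
  by rewrite mxE !big_ord_recl big_ord0 !mxE /= addr0 addrA.
by rewrite /incident; apply/eqP/eqP => [->|h]; [rewrite mxE
  | apply/matrixP => i j; rewrite !ord1 h mxE].
Qed.

Lemma incidentC x y : incident x y = incident y x.
Proof. by rewrite /incident -trmx_eq0 trmx_mul trmxK. Qed.

Lemma same_ptC p q : same_pt p q = same_pt q p.
Proof. by rewrite /same_pt andbC. Qed.

Lemma same_pt_refl p : same_pt p p.
Proof. by rewrite /same_pt submx_refl. Qed.

Lemma same_pt_trans : transitive (@same_pt K).
Proof.
move=> q p r /andP[pq qp] /andP[qr rq].
by rewrite /same_pt (submx_trans pq qr) (submx_trans rq qp).
Qed.

Lemma same_ptP p q : q != 0 ->
  reflect (exists2 k : K, k != 0 & p = k *: q) (same_pt p q).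
Proof.
move=> q0; apply: (iffP andP) => [[/sub_rVP[k ->] h]|[k k0 ->]].
  exists k => //; apply: contraNneq q0 => k0; move: h.
  by rewrite k0 scale0r => /sub_rVP[c ->]; rewrite scaler0.
by rewrite scalemx_sub // -{1}[q](scalerK k0) scalemx_sub.
Qed.

Lemma same_ptZ (k k' : K) p q : k != 0 -> k' != 0 ->
  same_pt (k *: p) (k' *: q) = same_pt p q.
Proof.
move=> k0 k'0.
by rewrite /same_pt !(eqmx_scale _ k0) !(eqmx_scale _ k'0).
Qed.

Lemma same_ptE p q : p != 0 -> q != 0 -> same_pt p q = (p <= q)%MS.
Proof.
move=> p0 q0; apply/andP/idP => [[] //|pq]; split=> //.
by rewrite -(geq_leqif (mxrank_leqif_sup pq)) !rank_rV p0 q0.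
Qed.

Lemma same_pt_hpt (x0 x1 x2 y0 y1 y2 : K) :
  hpt x0 x1 x2 != 0 -> hpt y0 y1 y2 != 0 ->
  same_pt (hpt x0 x1 x2) (hpt y0 y1 y2)
  = [&& x0 * y1 == x1 * y0, x0 * y2 == x2 * y0 & x1 * y2 == x2 * y1].
Proof.
move=> x0n y0n; apply/idP/and3P.
  case/(same_ptP _ y0n) => k _ /eqP.
  rewrite scale_hpt hpt_eq => /and3P[/eqP-> /eqP-> /eqP->].
  by split; apply/eqP; ring.
case=> /eqP e01 /eqP e02 /eqP e12; rewrite same_ptE //; apply/sub_rVP.
move: y0n; rewrite hpt_eq0 !negb_and => /or3P[] h.
- exists (x0 / y0); apply/eqP; rewrite scale_hpt hpt_eq.
  by rewrite divfK // mulrAC e01 mulfK // mulrAC e02 mulfK ?eqxx.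
- exists (x1 / y1); apply/eqP; rewrite scale_hpt hpt_eq.
  by rewrite divfK // mulrAC -e01 mulfK // mulrAC e12 mulfK ?eqxx.
- exists (x2 / y2); apply/eqP; rewrite scale_hpt hpt_eq.
  by rewrite divfK // mulrAC -e02 mulfK // mulrAC -e12 mulfK ?eqxx.
Qed.

Lemma rank_join p q : p != 0 -> q != 0 -> ~~ same_pt p q ->
  \rank (p + q)%MS = 2.
Proof.
move=> p0 q0 pq; apply/eqP; rewrite eqn_leq; apply/andP; split.
  by apply: leq_trans (mxrank_adds_leqif p q).1 _; rewrite !rank_rV p0 q0.
have : (q < p + q)%MS.
  by rewrite ltmxE addsmxSr addsmx_sub submx_refl andbT -same_ptE.
by move/rank_ltmx; rewrite rank_rV q0.
Qed.

(** The lines through two distinct points form the kernel of a matrix of rank 2, which is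
    one-dimensional. *)
Lemma incident_unique p q l m : p != 0 -> q != 0 -> ~~ same_pt p q ->
  l != 0 -> m != 0 -> incident p l -> incident q l ->
  incident p m -> incident q m -> same_pt l m.
Proof.
move=> p0 q0 pq l0 m0 pl ql pm qm.
pose M := kermx (col_mx p q)^T.
have sub x : incident p x -> incident q x -> (x <= M)%MS.
  move=> px qx; rewrite sub_kermx tr_col_mx mul_mx_row.
  move: px qx; rewrite incidentC [incident q x]incidentC.
  by rewrite /incident => /eqP-> /eqP->; rewrite row_mx0.
have rM : \rank M = 1.
  by rewrite mxrank_ker mxrank_tr -addsmxE rank_join.
have eqM x : x != 0 -> (x <= M)%MS -> (M <= x)%MS.
  by move=> x0 xM; rewrite -(geq_leqif (mxrank_leqif_sup xM)) rM rank_rV x0.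
by rewrite same_ptE // (submx_trans (sub l pl ql)) // eqM // sub.
Qed.

(** The join is contained in the kernel of [l^T], and both have rank 2. This turns a condition on
    hypotenuses into a linear equation. *)
Lemma sub_join p q g l : p != 0 -> q != 0 -> ~~ same_pt p q -> l != 0 ->
  incident p l -> incident q l -> (g <= p + q)%MS = incident g l.
Proof.
move=> p0 q0 pq l0 pl ql.
have s : (p + q <= kermx l^T)%MS.
  by rewrite addsmx_sub !sub_kermx; apply/andP.
have /eqmxP e : (p + q == kermx l^T)%MS.
  rewrite s -(geq_leqif (mxrank_leqif_sup s)) rank_join //.
  by rewrite mxrank_ker mxrank_tr rank_rV l0.
by rewrite e sub_kermx.
Qed.

(** When p and q coincide, the tangent clause of [chord] replaces the missing second point. *)
Lemma chord_unique Q p q l m : p != 0 -> q != 0 ->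
  chord Q p q l -> chord Q p q m -> same_pt l m.
Proof.
move=> p0 q0 [l0 pl ql tl] [m0 pm qm tm].
have [pq|pq] := boolP (same_pt p q); last exact: (@incident_unique p q).
by rewrite (same_pt_trans (tl pq)) // same_ptC tm.
Qed.

Lemma perpendicular_same l l' m m' : same_pt l l' -> same_pt m m' ->
  perpendicular l m -> perpendicular l' m'.
Proof.
move=> /andP[_ /sub_rVP[k ->]] /andP[_ /sub_rVP[k' ->]].
rewrite /perpendicular /incident => /eqP h.
by rewrite -!scalemxAl linearZ /= -scalemxAr h !scaler0.
Qed.

(** A Fregier point lies on all hypotenuses itself, so any second one coincides with it. Exhibiting
    a single one for each p therefore settles the locus. *)
Lemma fregier_point_unique Q p f f' : fregier_point Q p f' ->
  fregier_point Q p f <-> f != 0 /\ same_pt f f'.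
Proof.
case=> f'0 h'; split=> [[f0 h]|[f0 ff']]; split=> //.
  by apply/h' => //; apply/h => //; exact: same_pt_refl.
move=> g g0; split=> [/h' h|gf].
  by apply: (@same_pt_trans f'); [exact: h | rewrite same_ptC].
by apply/h' => //; apply: same_pt_trans ff'.
Qed.

Lemma perpendicular_hpt (x0 x1 x2 y0 y1 y2 : K) :
  perpendicular (hpt x0 x1 x2) (hpt y0 y1 y2)
  = (x1 * y1 + x2 * y2 - x0 * y0 == 0).
Proof.
have inv : invmx absolute = absolute :> 'M[K]_3.
  have e : absolute *m absolute = 1%:M :> 'M[K]_3.
    rewrite mulmx_diag -diag_const_mx; congr diag_mx.
    by rewrite [LHS]hpt_eta [RHS]hpt_eta !mxE /= mulrNN !mulr1.
  have [u _] := mulmx1_unit e.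
  by rewrite -[LHS]mulmx1 -e mulmxA mulVmx // mul1mx.
rewrite /perpendicular inv hpt_mul_diag incident_hpt; congr (_ == _); ring.
Qed.

End Field.

(** Elimination with explicit cofactors a and b; the remaining identity is left to [ring]. *)
Lemma lincomb_eq0 (A : comNzRingType) (a b x y z : A) :
  x = 0 -> y = 0 -> z = a * x + b * y -> z = 0.
Proof. by move=> -> -> ->; rewrite !mulr0 addr0. Qed.

(** * Rational parametrization of C, right triangles and Fregier points *)

Section Param.
Variables (K : numFieldType) (lam : K).
Hypotheses (lam0 : lam != 0) (lam1 : lam + 1 != 0).
Implicit Types (k c s t : K) (p q r f g l m : 'rV[K]_3).

(* u : v : w = (lam + 1) s^2 : - lam t^2 : (lam + 1) s t *)
Definition conic_pt (s t : K) : 'rV[K]_3 :=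
  hpt (- ((lam + 1) * s ^+ 2 + lam * t ^+ 2))
      ((lam + 1) * s ^+ 2 - lam * t ^+ 2) (2 * (lam + 1) * s * t).

(** In the coordinates u, v, w this is lam t t' u - (lam + 1) s s' v - lam (s t' + s' t) w = 0, the
    polarized equation of the tangent. *)
Definition chord_line (s t s' t' : K) : 'rV[K]_3 :=
  hpt (- ((lam + 1) * s * s') - lam * t * t')
      (lam * t * t' - (lam + 1) * s * s') (- (lam * (s * t' + s' * t))).

Definition fregier_map p : 'rV[K]_3 :=
  p *m diag_mx (hpt lam lam (lam + 2)).

Lemma conicCE : conicC lam = diag_mx (hpt (- (lam + 1)) (lam + 1) lam).
Proof.
rewrite /conicC /absolute /tangent_pair -linearZ -linearD /=; congr diag_mx.
rewrite [LHS]hpt_eta !mxE /=; congr hpt; ring.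
Qed.

Lemma conic_pt_neq0 s t : (s != 0) || (t != 0) -> conic_pt s t != 0.
Proof.
move=> h; apply/negP; rewrite hpt_eq0 => /and3P[/eqP e0 /eqP e1 _].
have /eqP : 2 * (lam + 1) * s ^+ 2 = 0.
  by apply: (@lincomb_eq0 _ (-1) 1 _ _ _ e0 e1); ring.
have /eqP : 2 * lam * t ^+ 2 = 0.
  by apply: (@lincomb_eq0 _ (-1) (-1) _ _ _ e0 e1); ring.
rewrite !mulf_eq0 !pnatr_eq0 (negPf lam0) (negPf lam1) !orbb /= => ht hs.
by move: h; rewrite hs ht.
Qed.

(** Along the parametrization u : w = s : t, which recovers the parameter if u is nonzero. On C, u =
    0 forces w = 0, and this one point has parameter (0 : 1). *)
Lemma on_conicC_pt p : on_conic (conicC lam) p ->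
  exists k s t : K, [/\ k != 0, (s != 0) || (t != 0) & p = k *: conic_pt s t].
Proof.
move: p; apply: hptW => x0 x1 x2 /andP[]; rewrite qform_conicC => p0 /eqP e.
have [u0|u0] := eqVneq (x1 - x0) 0.
  have x20 : x2 = 0.
    apply/eqP; rewrite -sqrf_eq0; apply/eqP/(mulfI lam0).
    rewrite mulr0 -e; have -> : x1 = x0 by apply/eqP; rewrite -subr_eq0 u0.
    ring.
  have e1 : x1 = x0 by apply/eqP; rewrite -subr_eq0 u0.
  exists (x0 / - lam), 0, 1; split; last 2 first.
  - by rewrite oner_eq0 orbT.
  - apply/eqP; rewrite scale_hpt hpt_eq x20 e1.
    by apply/and3P; split; apply/eqP; field.
  rewrite mulf_neq0 ?invr_eq0 ?oppr_eq0 //.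
  by move: p0; rewrite hpt_eq0 e1 x20 eqxx andbT andbb.
have two : 2 != 0 :> K by rewrite pnatr_eq0.
(* With s = u and t = w the parametrized point has first coordinate 2 (lam + 1) u^2, so this factor
   restores u. *)
exists (2 * (lam + 1) * (x1 - x0))^-1, (x1 - x0), x2; split; last 2 first.
- by rewrite u0.
- apply/eqP; rewrite scale_hpt hpt_eq.
  have {}e : lam * x2 ^+ 2 = - ((lam + 1) * (x1 - x0) * (x1 + x0)).
    by apply/eqP; rewrite -addr_eq0 -e; apply/eqP; ring.
  by apply/and3P; split; apply/eqP; rewrite ?e; field; rewrite ?two ?lam1 ?u0.
by rewrite invr_eq0 !mulf_neq0.
Qed.

Lemma conic_pt_on k s t : k != 0 -> (s != 0) || (t != 0) ->
  on_conic (conicC lam) (k *: conic_pt s t).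
Proof.
move=> k0 st; rewrite /on_conic scaler_eq0 negb_or k0 conic_pt_neq0 //=.
by rewrite scale_hpt qform_conicC; apply/eqP; ring.
Qed.

(** Every minor contains the factor s t' - s' t. If it were nonzero, the cofactors would give s s' =
    0 and s t' + s' t = 0, and these make it vanish. *)
Lemma same_conic_pt k s t k' s' t' : k != 0 -> k' != 0 ->
  (s != 0) || (t != 0) -> (s' != 0) || (t' != 0) ->
  same_pt (k *: conic_pt s t) (k' *: conic_pt s' t') = (s * t' == s' * t).
Proof.
move=> k0 k'0 st st'.
have two : 2 != 0 :> K by rewrite pnatr_eq0.
have n : conic_pt s t != 0 by apply: conic_pt_neq0.
have n' : conic_pt s' t' != 0 by apply: conic_pt_neq0.
rewrite same_ptZ // same_pt_hpt // -!(subr_eq0 (_ * _)).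
apply/and3P/eqP => [[/eqP e01 /eqP e02 /eqP e12]|e]; last first.
  split; apply/eqP.
  - by rewrite -[RHS](mulr0 (2 * (lam + 1) * lam * (s * t' + s' * t))) -e; ring.
  - rewrite -[RHS](mulr0 (2 * (lam + 1) * (lam * t * t' - (lam + 1) * s * s'))).
    by rewrite -e; ring.
  - rewrite -[RHS](mulr0 (2 * (lam + 1) * (lam * t * t' + (lam + 1) * s * s'))).
    by rewrite -e; ring.
apply/eqP/contraT => d0.
have/eqP : 4 * (lam + 1) ^+ 2 * (s * s') * (s * t' - s' * t) = 0.
  by apply: (@lincomb_eq0 _ 1 (-1) _ _ _ e12 e02); ring.
have/eqP : 4 * (lam + 1) * lam * (s * t' + s' * t) * (s * t' - s' * t) = 0.
  by rewrite -[RHS](mulr0 2) -e01; ring.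
rewrite !mulf_eq0 (negPf d0) (negPf lam0) (negPf lam1) pnatr_eq0 /= ?orbF.
move=> h1 /orP[] /eqP z; move: d0 h1; rewrite z !mul0r.
  by rewrite sub0r oppr_eq0 add0r => /negPf->.
by rewrite subr0 addr0 => /negPf->.
Qed.

Lemma incident_conic_pt_chord_line k s1 t1 s t s' t' :
  incident (k *: conic_pt s1 t1) (chord_line s t s' t') =
  (k * (2 * (lam + 1) * lam) * (s * t1 - s1 * t) * (s' * t1 - s1 * t') == 0).
Proof. by rewrite scale_hpt incident_hpt; congr (_ == 0); ring. Qed.

(** The numbers s s', s t' + s' t, t t' are the coefficients of a product of two nonzero linear
    forms, so they are not all zero. *)
Lemma chord_line_neq0 s t s' t' : (s != 0) || (t != 0) ->
  (s' != 0) || (t' != 0) -> chord_line s t s' t' != 0.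
Proof.
move=> st st'; rewrite hpt_eq0; apply/negP => /and3P[/eqP e0 /eqP e1].
have two : 2 != 0 :> K by rewrite pnatr_eq0.
rewrite oppr_eq0 mulf_eq0 (negPf lam0) /= => h.
have : 2 * (lam + 1) * (s * s') == 0.
  by apply/eqP/(@lincomb_eq0 _ (-1) (-1) _ _ _ e0 e1); ring.
have : 2 * lam * (t * t') == 0.
  by apply/eqP/(@lincomb_eq0 _ (-1) 1 _ _ _ e0 e1); ring.
rewrite !mulf_eq0 (negPf two) (negPf lam0) (negPf lam1) /= => hT hS.
case/orP: st => n.
  move: hS st' h; rewrite (negPf n) /= => /eqP->.
  by rewrite eqxx /= mul0r addr0 mulf_eq0 (negPf n) => /negPf->.
move: hT st' h; rewrite (negPf n) /= => /eqP->.
by rewrite eqxx orbF mulr0 add0r mulf_eq0 (negPf n) orbF => /negPf->.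
Qed.

Lemma polar_conic_pt k s t :
  polar (conicC lam) (k *: conic_pt s t) =
  (- (k * (lam + 1))) *: chord_line s t s t.
Proof.
rewrite /polar conicCE !scale_hpt hpt_mul_diag.
by apply/eqP; rewrite hpt_eq; apply/and3P; split; apply/eqP; ring.
Qed.

Lemma chord_chord_line k k' s t s' t' : k != 0 -> k' != 0 ->
  (s != 0) || (t != 0) -> (s' != 0) || (t' != 0) ->
  chord (conicC lam) (k *: conic_pt s t) (k' *: conic_pt s' t')
    (chord_line s t s' t').
Proof.
move=> k0 k'0 st st'; split.
- exact: chord_line_neq0.
- by rewrite incident_conic_pt_chord_line subrr mulr0 mul0r.
- by rewrite incident_conic_pt_chord_line subrr mulr0.
rewrite same_conic_pt // => /eqP e; rewrite polar_conic_pt.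
(* Coinciding points have proportional parameters, and rescaling one parameter pair only rescales
   the chord. *)
have [c c0 [-> ->]] : exists2 c, c != 0 & s' = c * s /\ t' = c * t.
  have cn (c : K) : s' = c * s -> t' = c * t -> c != 0.
    by move=> es et; apply: contraTneq st' => z; rewrite es et z !mul0r eqxx.
  case/orP: st => n0; [exists (s' / s) | exists (t' / t)].
  - by apply: cn; rewrite ?divfK // mulrAC -e mulrC mulKf.
  - by rewrite divfK // mulrAC -e [s * t']mulrC mulfK.
  - by apply: cn; rewrite ?divfK // mulrAC [t' * s]mulrC e mulfK.
  - by rewrite divfK // mulrAC [t' * s]mulrC e mulfK.
have -> : chord_line s t (c * s) (c * t) = c *: chord_line s t s t.
  rewrite scale_hpt; apply/eqP; rewrite hpt_eq.
  by apply/and3P; split; apply/eqP; ring.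
by rewrite same_ptZ ?same_pt_refl // oppr_eq0 mulf_neq0.
Qed.

(** The form bilinear in (s1 : t1) and (s2 : t2) is the same as in [perpendicular_chord_line]; this
    coincidence is what sends all hypotenuses through one point. *)
Lemma incident_fregier_map k s t s1 t1 s2 t2 :
  incident (fregier_map (k *: conic_pt s t)) (chord_line s1 t1 s2 t2) =
  (k * (2 * (lam + 1) * lam) *
   (lam * s ^+ 2 * t1 * t2 + lam * t ^+ 2 * s1 * s2
    - (lam + 2) * s * t * (s1 * t2 + s2 * t1)) == 0).
Proof.
rewrite /fregier_map scale_hpt hpt_mul_diag incident_hpt.
by congr (_ == 0); ring.
Qed.

Lemma perpendicular_chord_line s t s1 t1 s2 t2 :
  perpendicular (chord_line s t s1 t1) (chord_line s t s2 t2) =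
  (lam * (lam * s ^+ 2 * t1 * t2 + lam * t ^+ 2 * s1 * s2
    - (lam + 2) * s * t * (s1 * t2 + s2 * t1)) == 0).
Proof. by rewrite perpendicular_hpt; congr (_ == 0); ring. Qed.

(** Chords are unique up to a factor, so the legs may be taken to be the explicit [chord_line]s. *)
Lemma right_triangle_conic_pt k s t k1 s1 t1 k2 s2 t2 :
  k != 0 -> k1 != 0 -> k2 != 0 -> (s != 0) || (t != 0) ->
  (s1 != 0) || (t1 != 0) -> (s2 != 0) || (t2 != 0) ->
  right_triangle (conicC lam) (k *: conic_pt s t) (k1 *: conic_pt s1 t1)
    (k2 *: conic_pt s2 t2) <->
  s1 * t2 != s2 * t1 /\
  incident (fregier_map (k *: conic_pt s t)) (chord_line s1 t1 s2 t2).
Proof.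
move=> k0 k10 k20 st st1 st2.
have -> : incident (fregier_map (k *: conic_pt s t)) (chord_line s1 t1 s2 t2) =
   perpendicular (chord_line s t s1 t1) (chord_line s t s2 t2).
  rewrite incident_fregier_map perpendicular_chord_line !mulf_eq0.
  by rewrite (negPf k0) (negPf lam0) (negPf lam1) pnatr_eq0.
have n k' s' t' : k' != 0 -> (s' != 0) || (t' != 0) ->
    k' *: conic_pt s' t' != 0.
  by move=> ? ?; rewrite scaler_eq0 negb_or conic_pt_neq0 // andbT.
have C1 := chord_chord_line k0 k10 st st1.
have C2 := chord_chord_line k0 k20 st st2.
split=> [[_ _ d [l [m [Cl Cm lm]]]]|[d lm]].
  split; first by rewrite same_conic_pt in d.
  apply: (perpendicular_same _ _ lm).
    by apply: (chord_unique _ _ Cl C1); exact: n.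
  by apply: (chord_unique _ _ Cm C2); exact: n.
split; [exact: conic_pt_on|exact: conic_pt_on|by rewrite same_conic_pt|].
by exists (chord_line s t s1 t1), (chord_line s t s2 t2).
Qed.

(** The map is injective unless lam = -2; then its kernel is the point [0, 0, 1], which is not on
    C. *)
Lemma fregier_map_neq0 p : on_conic (conicC lam) p -> fregier_map p != 0.
Proof.
move: p; apply: hptW => x0 x1 x2 /andP[]; rewrite qform_conicC => p0 /eqP e.
rewrite /fregier_map hpt_mul_diag; apply: contra p0; rewrite !hpt_eq0.
rewrite !mulf_eq0 (negPf lam0) !orbF => /and3P[/eqP z0 /eqP z1 _].
have : lam * x2 ^+ 2 == 0 by apply/eqP; rewrite -e z0 z1; ring.
by rewrite mulf_eq0 (negPf lam0) sqrf_eq0 z0 z1 eqxx.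
Qed.

(** The image of p is on every hypotenuse by the common bilinear form. It is the only such point
    because some two hypotenuses differ, and these are exhibited case by case. *)
Lemma fregier_point_map p : on_conic (conicC lam) p ->
  fregier_point (conicC lam) p (fregier_map p).
Proof.
move=> pC; split=> [|g g0]; first exact: fregier_map_neq0.
have f0 := fregier_map_neq0 pC.
have [k [s [t [k0 st pE]]]] := on_conicC_pt pC.
split=> [h|/andP[/sub_rVP[c gE] _] q r T]; last first.
  have [/on_conicC_pt[k1 [s1 [t1 [k10 st1 qE]]]]] := T.
  move=> /on_conicC_pt[k2 [s2 [t2 [k20 st2 rE]]]] qr _.
  move: T; rewrite pE qE rE => /right_triangle_conic_pt[] // d fi.
  rewrite (@sub_join _ _ _ _ (chord_line s1 t1 s2 t2)).
  - by rewrite gE /incident -scalemxAl pE (eqP fi) scaler0.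
  - by rewrite scaler_eq0 negb_or k10 conic_pt_neq0.
  - by rewrite scaler_eq0 negb_or k20 conic_pt_neq0.
  - by rewrite same_conic_pt.
  - exact: chord_line_neq0.
  - by rewrite incident_conic_pt_chord_line subrr mulr0 mul0r.
  - by rewrite incident_conic_pt_chord_line subrr mulr0.
have H s1 t1 s2 t2 : (s1 != 0) || (t1 != 0) -> (s2 != 0) || (t2 != 0) ->
    s1 * t2 != s2 * t1 ->
    lam * s ^+ 2 * t1 * t2 + lam * t ^+ 2 * s1 * s2
      - (lam + 2) * s * t * (s1 * t2 + s2 * t1) = 0 ->
    incident (fregier_map p) (chord_line s1 t1 s2 t2) /\
    incident g (chord_line s1 t1 s2 t2).
  move=> st1 st2 d e.
  have fi : incident (fregier_map p) (chord_line s1 t1 s2 t2).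
    by rewrite pE incident_fregier_map e mulr0.
  split=> //; rewrite -(@sub_join _ (1 *: conic_pt s1 t1) (1 *: conic_pt s2 t2)).
  - by apply: h; rewrite pE; apply/right_triangle_conic_pt;
      rewrite ?oner_eq0 -?pE.
  - by rewrite scale1r conic_pt_neq0.
  - by rewrite scale1r conic_pt_neq0.
  - by rewrite same_conic_pt ?oner_eq0.
  - exact: chord_line_neq0.
  - by rewrite incident_conic_pt_chord_line subrr mulr0 mul0r.
  - by rewrite incident_conic_pt_chord_line subrr mulr0.
have two : 2 != 0 :> K by rewrite pnatr_eq0.
have {}H s1 t1 s2 t2 s3 t3 s4 t4 :
    (s1 != 0) || (t1 != 0) -> (s2 != 0) || (t2 != 0) ->
    (s3 != 0) || (t3 != 0) -> (s4 != 0) || (t4 != 0) ->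
    s1 * t2 != s2 * t1 -> s3 * t4 != s4 * t3 ->
    lam * s ^+ 2 * t1 * t2 + lam * t ^+ 2 * s1 * s2
      - (lam + 2) * s * t * (s1 * t2 + s2 * t1) = 0 ->
    lam * s ^+ 2 * t3 * t4 + lam * t ^+ 2 * s3 * s4
      - (lam + 2) * s * t * (s3 * t4 + s4 * t3) = 0 ->
    ~~ same_pt (chord_line s1 t1 s2 t2) (chord_line s3 t3 s4 t4) ->
    same_pt g (fregier_map p).
  move=> st1 st2 st3 st4 d d' e e' n.
  have [f1 g1] := H _ _ _ _ st1 st2 d e.
  have [f2 g2] := H _ _ _ _ st3 st4 d' e'.
  apply: (incident_unique _ _ n); rewrite 1?incidentC //.
    exact: chord_line_neq0.
  exact: chord_line_neq0.
have n10 : (1 != 0 :> K) || (0 != 0 :> K) by rewrite oner_eq0.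
have n01 : (0 != 0 :> K) || (1 != 0 :> K) by rewrite oner_eq0 orbT.
have n11 : (1 != 0 :> K) || (1 != 0 :> K) by rewrite oner_eq0.
have d10 : 1 * 1 != 0 * 0 :> K by rewrite mulr1 mulr0 oner_eq0.
(* Sum and difference of two minors of the chords separate the s-products from the t-products. *)
have ns (s1 t1 s2 t2 s3 t3 s4 t4 : K) :
    (s1 != 0) || (t1 != 0) -> (s2 != 0) || (t2 != 0) ->
    (s3 != 0) || (t3 != 0) -> (s4 != 0) || (t4 != 0) ->
    s1 * s2 * (s3 * t4 + s4 * t3) != s3 * s4 * (s1 * t2 + s2 * t1) \/
    t1 * t2 * (s3 * t4 + s4 * t3) != t3 * t4 * (s1 * t2 + s2 * t1) ->
    ~~ same_pt (chord_line s1 t1 s2 t2) (chord_line s3 t3 s4 t4).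
  move=> st1 st2 st3 st4; rewrite same_pt_hpt; try exact: chord_line_neq0.
  move=> dd; apply/negP; rewrite -!(subr_eq0 (_ * _)).
  case/and3P=> _ /eqP e1 /eqP e2; case: dd => /eqP; apply; apply/eqP.
    rewrite -subr_eq0.
    have /eqP : 2 * (lam * (lam + 1)) * (s1 * s2 * (s3 * t4 + s4 * t3)
        - s3 * s4 * (s1 * t2 + s2 * t1)) = 0.
      by apply: (@lincomb_eq0 _ 1 1 _ _ _ e1 e2); ring.
    by rewrite !mulf_eq0 (negPf lam0) (negPf lam1) (negPf two).
  rewrite -subr_eq0.
  have /eqP : 2 * (lam * lam) * (t1 * t2 * (s3 * t4 + s4 * t3)
      - t3 * t4 * (s1 * t2 + s2 * t1)) = 0.
    by apply: (@lincomb_eq0 _ 1 (-1) _ _ _ e1 e2); ring.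
  by rewrite !mulf_eq0 (negPf lam0) (negPf two).
(* At a contact point the pairing degenerates: p is paired with every point. *)
have [s0|s0] := eqVneq s 0.
  apply: (H 0 1 1 0 0 1 1 1); rewrite ?s0 //; try ring.
  - by rewrite mul0r mul1r eq_sym oner_eq0.
  - by rewrite !mulr1 eq_sym oner_eq0.
  apply: ns => //; right; rewrite !(mulr0, mulr1, mul0r, add0r).
  by rewrite eq_sym oner_eq0.
have [t0|t0] := eqVneq t 0.
  apply: (H 1 0 0 1 1 0 1 1); rewrite ?t0 //; try ring.
  - by rewrite mulr1 mulr0 oner_eq0.
  apply: ns => //; left; rewrite !(mulr0, mulr1, mul0r, add0r, addr0).
  by rewrite eq_sym oner_eq0.
(* Two triangles with different hypotenuses: (s : t) is paired with (s : - t),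
   and the contact point (1 : 0) is not paired with (s : t). *)
have n3 : (s != 0) || (- t != 0) by rewrite s0.
(* The partner of (1 : 0): the pairing with it reads lam t^2 s4 = (lam + 2) s t t4. *)
have n4 : (- ((lam + 2) * s * t) != 0) || (- (lam * t ^+ 2) != 0).
  by rewrite !oppr_eq0 orbC mulf_neq0 // expf_neq0.
apply: (H s t s (- t) 1 0 _ _ st n3 n10 n4); try ring.
- by rewrite mulrN eq_sym -addr_eq0 -mulr2n mulrn_eq0 negb_or mulf_neq0.
- by rewrite mul1r mulr0 oppr_eq0 mulf_neq0 // expf_neq0.
apply: ns => //; left; rewrite [s * - t]mulrN addNr !mulr0 addr0 mul1r.
by rewrite mulf_neq0 ?mulf_neq0 ?oppr_eq0 ?mulf_neq0 ?expf_neq0.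
Qed.
End Param.

(** * Diagonal conics: regularity and double contact *)

Section Diagonal.
Variable K : fieldType.

Lemma unitmx_diag (a b c : K) :
  (diag_mx (hpt a b c) \in unitmx) = [&& a != 0, b != 0 & c != 0].
Proof.
rewrite unitmxE det_diag !big_ord_recl big_ord0.
by rewrite unitfE !mxE /= mulr1 !mulf_eq0 !negb_or.
Qed.

Lemma regular_diag (a b c : K) :
  regular (diag_mx (hpt a b c)) = [&& a != 0, b != 0 & c != 0].
Proof. by rewrite /regular tr_diag_mx eqxx unitmx_diag. Qed.

(** Rests on lam^3 + 5 lam^2 + 8 lam + 4 = (lam + 1) (lam + 2)^2, the source of the exceptional
    value -2. *)
Lemma conicFE (lam : K) : conicF lam =
  diag_mx (hpt (- ((lam + 1) * (lam + 2) ^+ 2)) ((lam + 1) * (lam + 2) ^+ 2)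
    (lam ^+ 3)).
Proof.
rewrite /conicF /absolute /tangent_pair -!linearZ -linearD /=; congr diag_mx.
rewrite [LHS]hpt_eta !mxE /=; congr hpt; ring.
Qed.

Lemma regular_conicF (lam : K) :
  regular (conicF lam) = [&& lam != 0, lam + 1 != 0 & lam + 2 != 0].
Proof.
rewrite conicFE regular_diag oppr_eq0 !mulf_eq0.
by case: (lam == 0) (lam + 1 == 0) (lam + 2 == 0) => [] [] [].
Qed.

Lemma line_contact (f : 'rV[K]_3) : (2 != 0 :> K) ->
  f 0 2 = 0 <-> (f <= contact1 + contact2)%MS.
Proof.
move=> two.
have o : (1 != 0 :> K) by rewrite oner_eq0.
rewrite (@sub_join _ _ _ _ (hpt 0 0 1)).
- rewrite (hpt_eta f) incident_hpt mxE /= !mulr0 mulr1 !add0r.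
  by split=> [->|/eqP].
- by rewrite hpt_eq0 (negPf o).
- by rewrite hpt_eq0 (negPf o).
- rewrite same_pt_hpt ?hpt_eq0 ?(negPf o) // !negb_and; apply/orP; left.
  by rewrite mulrN1 mulr1 -subr_eq0 -opprD oppr_eq0.
- by rewrite hpt_eq0 (negPf o) !andbF.
- by rewrite incident_hpt !mulr0 mul0r !addr0.
- by rewrite incident_hpt !mulr0 mul0r !addr0.
Qed.

End Diagonal.

(** C and F both have this shape. Eliminating x1^2 - x0^2 from the two equations leaves (b - a) x2^2
    = 0, so x2 = 0 and x1 is x0 or - x0; there the two polars differ by the factor a. *)
Lemma double_contact_diag (K : numFieldType) (a b : K) :
  a != 0 -> b != 0 -> a != b ->
  double_contact absolute (diag_mx (hpt (- a) a b)) contact1 contact2.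
Proof.
move=> a0 b0 ab.
have o : (1 != 0 :> K) by rewrite oner_eq0.
have two : (2 != 0 :> K) by rewrite pnatr_eq0.
have touchP (e : K) : e ^+ 2 = 1 ->
    touch absolute (diag_mx (hpt (- a) a b)) (hpt 1 e 0).
  move=> e2; rewrite /touch /on_conic qform_absolute qform_diag hpt_eq0 (negPf o).
  rewrite /= e2 /polar !hpt_mul_diag; apply/and3P; split.
  - by apply/eqP; ring.
  - by apply/eqP; ring.
  rewrite same_ptC; apply/same_ptP.
    by rewrite hpt_eq0 mul1r oppr_eq0 (negPf o).
  exists a => //; apply/eqP; rewrite scale_hpt hpt_eq.
  by apply/and3P; split; apply/eqP; ring.
split.
- rewrite same_pt_hpt ?hpt_eq0 ?(negPf o) // !negb_and; apply/orP; left.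
  by rewrite mulrN1 mulr1 -subr_eq0 -opprD oppr_eq0.
- by apply: touchP; ring.
- by apply: touchP; ring.
apply: hptW => x0 x1 x2; rewrite /on_conic qform_absolute qform_diag.
case/andP=> x0n /eqP e1 /andP[_ /eqP e2].
have /eqP : (b - a) * x2 ^+ 2 = 0.
  by apply: (@lincomb_eq0 _ (- a) 1 _ _ _ e1 e2); ring.
rewrite mulf_eq0 subr_eq0 eq_sym (negPf ab) sqrf_eq0 /= => /eqP x20.
have : (x1 - x0) * (x1 + x0) == 0 by apply/eqP; rewrite -e1 x20; ring.
have x00 : x1 = x0 \/ x1 = - x0 -> x0 != 0.
  move=> h; apply: contra x0n => /eqP z; rewrite hpt_eq0 x20 z eqxx andbT /=.
  by case: h => ->; rewrite z ?oppr0.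
rewrite mulf_eq0 subr_eq0 addr_eq0 => /orP[] /eqP e; [left|right].
  apply/same_ptP; [by rewrite hpt_eq0 (negPf o)|].
  exists x0; first by apply: x00; left.
  by rewrite e x20 /contact1 scale_hpt mulr1 mulr0.
apply/same_ptP; [by rewrite hpt_eq0 (negPf o)|].
exists x0; first by apply: x00; right.
by rewrite e x20 /contact2 scale_hpt mulr1 mulrN1 mulr0.
Qed.

(** * The Fregier locus as the image of C *)

Section Locus.
Variables (K : numFieldType) (lam : K).
Hypotheses (lam0 : lam != 0) (lam1 : lam + 1 != 0).

Lemma fregier_locus_map f : fregier_locus (conicC lam) f <->
  exists2 p, on_conic (conicC lam) p & same_pt f (fregier_map lam p).
Proof.
split=> -[p pC fp]; exists p => //; have F := fregier_point_map lam0 lam1 pC.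
  by case/(fregier_point_unique _ F): fp.
apply/(fregier_point_unique _ F); split=> //; case: F => F0 _.
by have /same_ptP[//|k k0 ->] := fp; rewrite scaler_eq0 negb_or k0.
Qed.

Lemma qformZ (k : K) (Q : 'M[K]_3) p : qform Q (k *: p) = k ^+ 2 * qform Q p.
Proof.
rewrite /qform linearZ /= -!scalemxAl -scalemxAr !mxE; ring.
Qed.

(** This explains the equation of F: pulled back along the map it is a multiple of C. For lam = -2
    the multiplier is zero and the converse inclusion needs a separate argument. *)
Lemma qform_fregier_map p :
  qform (conicF lam) (fregier_map lam p) =
  lam ^+ 2 * (lam + 2) ^+ 2 * qform (conicC lam) p.
Proof.
move: p; apply: hptW => x0 x1 x2.
rewrite /fregier_map hpt_mul_diag qform_conicF qform_conicC; ring.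
Qed.

Lemma on_conicF_map p f : on_conic (conicC lam) p ->
  same_pt f (fregier_map lam p) -> on_conic (conicF lam) f.
Proof.
move=> pC; have [F0 _] := fregier_point_map lam0 lam1 pC.
case/same_ptP=> // k k0 ->; rewrite /on_conic scaler_eq0 negb_or k0 F0 qformZ /=.
by rewrite qform_fregier_map; case/andP: pC => _ /eqP->; rewrite !mulr0.
Qed.

Lemma fregier_conicF : lam + 2 != 0 -> fregier_conic (conicC lam) (conicF lam).
Proof.
move=> lam2 f; rewrite fregier_locus_map.
split=> [[p pC fp]|]; first exact: on_conicF_map fp.
case/andP=> f0 /eqP fF.
(* The preimage of f under the diagonal map, invertible because lam + 2 is nonzero. *)
pose p := f *m diag_mx (hpt lam^-1 lam^-1 (lam + 2)^-1).
have pf : fregier_map lam p = f.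
  rewrite /fregier_map /p; move: (f); apply: hptW => x0 x1 x2.
  by rewrite !hpt_mul_diag !divfK.
exists p; last by rewrite pf same_pt_refl.
apply/andP; split.
  by apply: contra f0 => /eqP p0; rewrite -pf p0 /fregier_map mul0mx.
move/eqP: fF; rewrite -pf qform_fregier_map !mulf_eq0.
by rewrite (negPf lam0) (negPf lam2).
Qed.

Lemma fregier_map02 p : fregier_map lam p 0 2 = (lam + 2) * p 0 2.
Proof.
by rewrite /fregier_map mul_mx_diag !mxE /= mulrC.
Qed.

(** Geometrically, the projection from [0, 0, 1] onto the line x2 = 0. *)
Lemma fregier_map_two (x0 x1 x2 : K) : lam = -2 ->
  fregier_map lam (hpt x0 x1 x2) = -2 *: hpt x0 x1 0.
Proof.
move=> ->; rewrite /fregier_map hpt_mul_diag scale_hpt.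
by apply/eqP; rewrite hpt_eq; apply/and3P; split; apply/eqP; ring.
Qed.

(** The contact points have parameters (0 : 1) and (1 : 0), where the perpendicularity form reduces
    to - (lam + 2) s t. *)
Lemma perpendicular_contact p l m : lam = -2 -> on_conic (conicC lam) p ->
  chord (conicC lam) p contact1 l -> chord (conicC lam) p contact2 m ->
  perpendicular l m.
Proof.
move=> e pC.
have o : (1 != 0 :> K) by rewrite oner_eq0.
have two : (2 != 0 :> K) by rewrite pnatr_eq0.
have [k [s [t [k0 st ->]]]] := on_conicC_pt lam0 lam1 pC.
have c1 : contact1 = 2^-1 *: conic_pt lam 0 1.
  by rewrite scale_hpt e; congr hpt; field.
have c2 : contact2 = 1 *: conic_pt lam 1 0.
  by rewrite scale_hpt e; congr hpt; ring.
have h : 2^-1 != 0 :> K by rewrite invr_eq0.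
have n10 : (1 != 0 :> K) || (0 != 0 :> K) by rewrite o.
have n01 : (0 != 0 :> K) || (1 != 0 :> K) by rewrite o orbT.
have C1 := chord_chord_line lam0 lam1 k0 h st n01.
have C2 := chord_chord_line lam0 lam1 k0 o st n10.
have nz : k *: conic_pt lam s t != 0.
  by have /andP[] := conic_pt_on lam0 lam1 k0 st.
have n1 : 2^-1 *: conic_pt lam 0 1 != 0.
  by have /andP[] := conic_pt_on lam0 lam1 h n01.
have n2 : 1 *: conic_pt lam 1 0 != 0.
  by have /andP[] := conic_pt_on lam0 lam1 o n10.
rewrite c1 c2 => Cl Cm.
apply: (perpendicular_same (chord_unique nz n1 C1 Cl)
  (chord_unique nz n2 C2 Cm)).
by rewrite perpendicular_chord_line e; apply/eqP; ring.
Qed.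

End Locus.

(** * The degenerate case lam = -2, and symmetries of the pencil *)

Lemma fregier_locus_line (K : numClosedFieldType) (f : 'rV[K]_3) :
  fregier_locus (conicC (-2)) f <-> f != 0 /\ f 0 2 = 0.
Proof.
have two : (2 != 0 :> K) by rewrite pnatr_eq0.
have lam0 : (-2 != 0 :> K) by rewrite oppr_eq0.
have lam1 : (-2 + 1 != 0 :> K).
  by rewrite [X in X != 0](_ : _ = -1) ?oppr_eq0 ?oner_eq0 //; ring.
rewrite fregier_locus_map //; split=> [[p pC]|[]].
  have [F0 _] := fregier_point_map lam0 lam1 pC.
  case/same_ptP=> // k k0 ->; rewrite scaler_eq0 negb_or k0 F0; split=> //.
  by rewrite mxE fregier_map02 addNr mul0r mulr0.
(* On C with lam = -2, x2^2 = (x0^2 - x1^2) / 2; a closed field supplies the root, so every point of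
   the line lifts to C. *)
rewrite (hpt_eta f) hpt2; set x0 := f 0 0; set x1 := f 0 1 => + e.
rewrite e => f0; exists (hpt x0 x1 (sqrtC ((x0 ^+ 2 - x1 ^+ 2) / 2))).
  rewrite /on_conic qform_conicC sqrtCK; apply/andP; split.
    by move: f0; rewrite !hpt_eq0 !negb_and eqxx orbF orbA => ->.
  by apply/eqP; field.
by rewrite fregier_map_two // -[X in same_pt X _]scale1r same_ptZ
  ?same_pt_refl ?oner_eq0.
Qed.

(** For lam = -2 the coefficients of the pencil are -8 and 8, which leaves the double line x2^2 =
    0. *)
Lemma on_conicF_line (K : numFieldType) (f : 'rV[K]_3) :
  on_conic (conicF (-2)) f <-> f != 0 /\ f 0 2 = 0.
Proof.
move: f; apply: hptW => x0 x1 x2; rewrite /on_conic qform_conicF hpt2.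
rewrite (_ : _ + _ = - 8 * x2 ^+ 2); last by ring.
rewrite mulf_eq0 oppr_eq0 pnatr_eq0 sqrf_eq0 /=.
by split=> [/andP[? /eqP]|[-> ->]] //; rewrite eqxx.
Qed.

(** A symmetry sends the tangent pair T to k' T + c N; preservation of rank forces c = 0, and then
    k' = k. The resulting criterion is free of a and b, so C and F share their symmetries. *)
Lemma symmetry_pencil (K : numFieldType) (a b : K) (g : 'M[K]_3) :
  a != 0 -> b != 0 ->
  symmetry (a *: absolute + b *: tangent_pair K) g <->
  g \in unitmx /\ exists k : K, [/\ k != 0, g *m absolute *m g^T = k *: absolute
    & g *m tangent_pair K *m g^T = k *: tangent_pair K].
Proof.
move=> a0 b0; split=> [[gu [k k0 gN] [k' k'0]]|[gu [k [k0 gN gT]]]]; last first.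
  split=> //; exists k => //.
  rewrite mulmxDr mulmxDl -!scalemxAr -!scalemxAl gN gT scalerDr !scalerA.
  by rewrite ![k * _]mulrC.
rewrite mulmxDr mulmxDl -!scalemxAr -!scalemxAl gN => e.
pose c := a * (k' - k) / b.
have gT : g *m tangent_pair K *m g^T = k' *: tangent_pair K + c *: absolute.
  apply: (scalerI b0); apply: (addrI (a *: (k *: absolute))); rewrite e.
  rewrite !scalerDr !scalerA [RHS]addrCA [LHS]addrC [b * k']mulrC; congr (_ + _).
  by rewrite -scalerDl; congr (_ *: _); rewrite /c; field.
split=> //; exists k; split=> //.
suff c0 : c = 0.
  move: gT; rewrite c0 scale0r addr0; suff -> : k = k' by [].
  move/eqP: c0; rewrite /c !mulf_eq0 invr_eq0 (negPf a0) (negPf b0) orbF subr_eq0.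
  by move/eqP.
have o : (1 != 0 :> K) by rewrite oner_eq0.
(* The rank of k' T + c N = diag (- (k' + c), k' + c, c) is 2 only for c = 0. *)
have rT : \rank (g *m tangent_pair K *m g^T) = 2.
  rewrite mxrankMfree ?row_free_unit ?unitmx_tr //.
  rewrite eqmxMfull ?row_full_unit //.
  apply/eqP; rewrite eqn_leq; apply/andP; split.
    rewrite -ltnS ltn_neqAle rank_leq_row andbT.
    have : tangent_pair K \notin unitmx.
      by rewrite unitmx_diag eqxx !andbF.
    by rewrite -row_full_unit.
  have : \rank (absolute : 'M[K]_3) = 3.
    by apply: mxrank_unit; rewrite unitmx_diag oppr_eq0 o.
  (* N has rank 3 and differs from T by a matrix of rank 1, so T has rank at least 2. *)
  have -> : absolute = tangent_pair K + delta_mx 2 2 :> 'M[K]_3.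
    apply/matrixP => i j; rewrite !mxE.
    by case: i j => [[|[|[|//]]] ?] [[|[|[|//]]] ?] /=; ring.
  by move=> h; have := mxrank_add (tangent_pair K) (delta_mx 2 2);
    rewrite h mxrank_delta addn1.
apply/eqP; apply: contraT => c0; move: rT; rewrite gT.
have -> : k' *: tangent_pair K + c *: absolute =
    diag_mx (hpt (- (k' + c)) (k' + c) c).
  rewrite -!linearZ -linearD; congr diag_mx.
  by rewrite [LHS]hpt_eta !mxE /=; congr hpt; ring.
(* With c nonzero, one or three diagonal entries are nonzero, never two. *)
have [z|z] := eqVneq (k' + c) 0.
  have -> : diag_mx (hpt (- (k' + c)) (k' + c) c) = c *: delta_mx 2 2.
    apply/matrixP => i j; rewrite !mxE z.
    by case: i j => [[|[|[|//]]] ?] [[|[|[|//]]] ?] /=; ring.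
  by rewrite mxrank_scale_nz // mxrank_delta.
by rewrite mxrank_unit // unitmx_diag oppr_eq0 z.
Qed.

(** * Interior points and real Fregier points *)

Section Real.
Variable R : realType.
Implicit Types a b lam : R.

(** On the conic a^2 (x1^2 + x2^2 - x0^2) = a (a - b) x2^2, so one sign decides for all points. *)
Lemma lies_inside_diag a b : a != 0 -> b != 0 ->
  lies_inside (diag_mx (hpt (- a) a b)) <-> a * (a - b) <= 0.
Proof.
move=> a0 b0; split=> [h|h].
  (* The point u : v : w = b : - a : a of the conic, where the absolute form is 4 a (a - b). *)
  have /h : on_conic (diag_mx (hpt (- a) a b)) (hpt (- a - b) (b - a) (2 * a)).
    rewrite /on_conic qform_diag hpt_eq0 mulf_eq0 pnatr_eq0 (negPf a0) !andbF /=.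
    by apply/eqP; ring.
  rewrite /interior /on_conic qform_absolute.
  have -> : (b - a) ^+ 2 + (2 * a) ^+ 2 - (- a - b) ^+ 2 = 4 * (a * (a - b)).
    by ring.
  rewrite pmulr_rlt0 ?ltr0n // mulf_eq0 pnatr_eq0 /=.
  by case=> [/ltW //|/andP[_ /eqP ->]].
apply: hptW => x0 x1 x2; rewrite /interior /on_conic qform_diag qform_absolute.
case/andP=> -> /eqP e; set n := (X in X < 0).
have : n <= 0.
  have a2 : 0 < a ^+ 2 by rewrite exprn_even_gt0.
  rewrite -(pmulr_rle0 _ a2).
  have -> : a ^+ 2 * n = a * (a - b) * x2 ^+ 2.
    apply/eqP; rewrite -subr_eq0; apply/eqP.
    by apply: (@lincomb_eq0 _ a 0 _ _ _ e (erefl 0)); rewrite /n; ring.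
  by apply: mulr_le0_ge0 => //; apply: sqr_ge0.
by rewrite le_eqVlt => /orP[->|]; [right|left].
Qed.

Lemma discriminant_gt0 lam : 0 < 5 * lam ^+ 2 + 8 * lam + 4.
(* Five times the quadratic is (5 lam + 4)^2 + 4. *)
Proof. by have := sqr_ge0 (5 * lam + 4); nra. Qed.

Lemma lies_inside_conicC lam : lam != 0 -> lam + 1 != 0 ->
  lies_inside (conicC lam) <-> lam + 1 <= 0.
Proof.
move=> lam0 lam1; rewrite conicCE lies_inside_diag //.
by rewrite (_ : _ - _ = 1) ?mulr1 //; ring.
Qed.

(** Here a - b is the positive quadratic and a is lam + 1 times a nonzero square, so the sign is
    that of lam + 1, as for C. *)
Lemma lies_inside_conicF lam : lam != 0 -> lam + 1 != 0 -> lam + 2 != 0 ->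
  lies_inside (conicF lam) <-> lam + 1 <= 0.
Proof.
move=> lam0 lam1 lam2; rewrite conicFE lies_inside_diag ?mulf_neq0 ?expf_neq0 //.
rewrite (_ : _ - _ = 5 * lam ^+ 2 + 8 * lam + 4); last by ring.
rewrite pmulr_lle0 ?discriminant_gt0 // pmulr_lle0 //.
by rewrite exprn_even_gt0.
Qed.

Lemma symmetry_conicF lam g : lam != 0 ->
  symmetry (conicC lam) g <-> symmetry (conicF lam) g.
Proof.
move=> lam0; rewrite /conicC -[tangent_pair _]scale1r !symmetry_pencil //.
- by rewrite expf_neq0.
- by rewrite gt_eqF // discriminant_gt0.
by rewrite oner_eq0.
Qed.

(** On C the image [x0, x1, 0] has x1^2 - x0^2 = -2 x2^2, negative away from the contact points.
    Conversely an interior point of the line makes x0^2 - x1^2 positive, so the lift to C is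
    real. *)
Lemma fregier_interior (f : 'rV[R]_3) :
  (exists p, [/\ on_conic (conicC (-2)) p, ~~ on_conic absolute p
     & fregier_point (conicC (-2)) p f]) <-> f 0 2 = 0 /\ interior f.
Proof.
have lam0 : (-2 != 0 :> R) by rewrite oppr_eq0 pnatr_eq0.
have lam1 : (-2 + 1 != 0 :> R) by apply/eqP; lra.
split=> [[p [pC pN pf]]|].
  have F := fregier_point_map lam0 lam1 pC; have [F0 _] := F.
  have /(fregier_point_unique _ F)[_ /same_ptP[//|k k0 ->]] := pf.
  move: p pC pN {pf F F0}; apply: hptW => x0 x1 x2.
  rewrite /on_conic qform_conicC qform_absolute => /andP[-> /eqP e] /= pN.
  rewrite fregier_map_two // mxE [_ 0 2]mxE hpt2 !mulr0; split=> //.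
  rewrite /interior !qformZ qform_absolute.
  rewrite pmulr_rlt0; last by rewrite exprn_even_gt0.
  rewrite pmulr_rlt0; last by rewrite exprn_even_gt0.
  have x2p : 0 < x2 ^+ 2.
    rewrite exprn_even_gt0 //=; apply: contra pN => /eqP z.
    apply/eqP; move: e; rewrite z; lra.
  by lra.
rewrite (hpt_eta f) hpt2; set x0 := f 0 0; set x1 := f 0 1 => -[-> fi].
move: (fi); rewrite /interior qform_absolute => n.
(* [Num.sqrt] is 0 on negative arguments; interiority makes this argument positive. *)
pose w := Num.sqrt ((x0 ^+ 2 - x1 ^+ 2) / 2).
have w2 : w ^+ 2 = (x0 ^+ 2 - x1 ^+ 2) / 2 by rewrite sqr_sqrtr //; lra.
have pC : on_conic (conicC (-2)) (hpt x0 x1 w).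
  rewrite /on_conic qform_conicC hpt_eq0; apply/andP; split; last first.
    by apply/eqP; rewrite w2; lra.
  by apply/negP => /and3P[/eqP z0 /eqP z1 _]; move: n; rewrite z0 z1; lra.
exists (hpt x0 x1 w); split=> //.
  rewrite /on_conic qform_absolute negb_and; apply/orP; right; rewrite w2.
  by apply/eqP; lra.
apply/(fregier_point_unique _ (fregier_point_map lam0 lam1 pC)).
split; last first.
  by rewrite fregier_map_two // -[X in same_pt X _]scale1r same_ptZ
    ?same_pt_refl ?oner_eq0.
rewrite hpt_eq0; apply/negP => /and3P[/eqP z0 /eqP z1 _].
by move: n; rewrite z0 z1; lra.
Qed.

(** Common points of C and N have x2 = 0, where the map is multiplication by lam. *)
Lemma fregier_point_contact lam (p f : 'rV[R]_3) : lam != 0 -> lam + 1 != 0 ->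
  on_conic (conicC lam) p -> on_conic absolute p ->
  fregier_point (conicC lam) p f -> same_pt f p.
Proof.
move=> lam0 lam1 pC pN.
have F := fregier_point_map lam0 lam1 pC; have [F0 _] := F.
case/(fregier_point_unique _ F) => _ h; apply: (same_pt_trans h).
move: {h F F0} pC pN.
move: p; apply: hptW => x0 x1 x2; rewrite /on_conic qform_conicC qform_absolute.
case/andP=> p0 /eqP e1 /andP[_ /eqP e2].
have /eqP : x2 ^+ 2 = 0.
  by apply: (@lincomb_eq0 _ (lam + 1) (-1) _ _ _ e2 e1); ring.
rewrite sqrf_eq0 => /eqP z; apply/same_ptP => //; exists lam => //.
by rewrite /fregier_map hpt_mul_diag scale_hpt z mul0r mulr0 ![lam * _]mulrC.
Qed.

End Real.

Theorem mainTheorem7 (R : realType) (lam : R)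
    (lam_neq0 : lam != 0) (lam_neqN1 : lam != -1) :
  (* C is a circle with the real points of tangency [1,1,0] and [1,-1,0] *)
  (circle (conicC lam%:C)
   /\ double_contact absolute (conicC lam%:C) contact1 contact2) /\
  (* the Fregier conic, over the complex points and over the real points *)
  fregier_conic (conicC lam%:C) (conicF lam%:C) /\
  (lam != -2 -> fregier_conic (conicC lam) (conicF lam)) /\
  (lam != -2 -> circle (conicF lam%:C)) /\
  (forall g : 'M[R]_3, symmetry (conicC lam) g <-> symmetry (conicF lam) g) /\
  (lam != -2 -> (lies_inside (conicF lam) <-> lies_inside (conicC lam))) /\
  (* singularity of the conic, first for an arbitrary value of the parameter *)
  (forall mu : R,
     ~~ regular (conicF mu) <-> mu ^+ 3 * (mu + 2) ^+ 4 * (mu + 1) ^+ 2 = 0) /\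
  (~~ regular (conicF lam) <-> lam = -2) /\
  (lam = -2 ->
     (* the Fregier locus is the line x_2 = 0 spanned by the points of tangency *)
     (forall f : 'rV[R[i]]_3,
        fregier_locus (conicC lam%:C) f <-> f != 0 /\ f 0 2 = 0) /\
     (forall f : 'rV[R[i]]_3,
        f 0 2 = 0 <-> (f <= contact1 + contact2)%MS) /\
     (* its real part: the interior points, and the points of contact, which
        are their own Fregier points *)
     (forall f : 'rV[R]_3,
        (exists p, [/\ on_conic (conicC lam) p, ~~ on_conic absolute p
                     & fregier_point (conicC lam) p f])
        <-> f 0 2 = 0 /\ interior f) /\
     (forall p f : 'rV[R]_3,
        on_conic (conicC lam) p -> on_conic absolute p ->
        fregier_point (conicC lam) p f -> same_pt f p) /\
     (* the angle over the two points of tangency is right *)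
     (forall p l m : 'rV[R[i]]_3,
        on_conic (conicC lam%:C) p ->
        chord (conicC lam%:C) p contact1 l ->
        chord (conicC lam%:C) p contact2 m ->
        perpendicular l m)).
Proof.
have lam1 : lam + 1 != 0 by rewrite addr_eq0.
have lam2E : (lam != -2) = (lam + 2 != 0) by rewrite addr_eq0.
have c0 : lam%:C != 0 :> R[i] by rewrite fmorph_eq0.
have cD (n : nat) : lam%:C + n%:R = (lam + n%:R)%:C :> R[i].
  by rewrite rmorphD rmorph_nat.
have c1 : lam%:C + 1 != 0 :> R[i] by rewrite (cD 1) fmorph_eq0.
have c2 : lam + 2 != 0 -> lam%:C + 2 != 0 :> R[i] by rewrite cD fmorph_eq0.
have cm2 : lam = -2 -> lam%:C = -2 :> R[i] by move->; rewrite rmorphN rmorph_nat.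
have dC : double_contact absolute (conicC lam%:C : 'M[R[i]]_3) contact1 contact2.
  rewrite conicCE; apply: double_contact_diag => //.
  by rewrite -subr_eq0 addrAC subrr add0r oner_eq0.
split; [split=> // |
  split; [|split; [|split; [|split; [|split; [|split; [|split]]]]]]].
- split; last by exists contact1, contact2.
  by rewrite conicCE regular_diag oppr_eq0 c1.
(* For lam = -2 the complex locus and the double line still have the same points. *)
- have [e|n] := eqVneq lam (-2).
    by move=> f; rewrite cm2 // fregier_locus_line on_conicF_line.
  by apply: fregier_conicF => //; apply: c2; rewrite -lam2E.
- by rewrite lam2E; apply: fregier_conicF.
- rewrite lam2E => l2; split; first by rewrite regular_conicF c0 c1 c2.
  exists contact1, contact2; rewrite conicFE; apply: double_contact_diag.
  + by rewrite mulf_neq0 ?expf_neq0 ?c2.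
  + by rewrite expf_neq0.
  rewrite -subr_eq0.
  (* The entries differ by the image of a positive real number, hence also over the complex
     numbers. *)
  rewrite (_ : _ - _ = (5 * lam ^+ 2 + 8 * lam + 4)%:C).
    by rewrite fmorph_eq0 gt_eqF // discriminant_gt0.
  rewrite !rmorphD !rmorphM !rmorph_nat; ring.
- by move=> g; apply: symmetry_conicF.
- by rewrite lam2E => l2; rewrite lies_inside_conicF // lies_inside_conicC.
- move=> mu; rewrite regular_conicF -!negb_or negbK.
  rewrite (rwP eqP) !mulf_eq0.
  by case: (mu == 0) (mu + 1 == 0) (mu + 2 == 0) => [] [] [].
- rewrite regular_conicF lam_neq0 lam1 -lam2E /= negbK.
  by split=> [/eqP|->].
move=> e; rewrite (cm2 e); split; last split; last split; last split.
- exact: fregier_locus_line.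
- by move=> f; apply: line_contact; rewrite pnatr_eq0.
- by rewrite e; apply: fregier_interior.
- by move=> p f; apply: fregier_point_contact.
- move=> p l m; apply: perpendicular_contact; rewrite -?(cm2 e) //.
Qed.
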